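(* Let $M\le N$ be positive integers, let $\mathcal{A}\in\mathbb{R}^{I_1\times\cdots\times I_N\times J_1\times\cdots\times J_M}$, let $\mathcal{P}_1\in\mathbb{R}^{J_1\times\cdots\times J_M}$ with $\|\mathcal{P}_1\|_F=1$, and let $m$ be an integer with $0<m\le\min(I_1\cdots I_N,\;J_1\cdots J_M)$. Suppose that $m$ steps of the Einstein tensor Lanczos bidiagonalization algorithm (ELB, described in the context) applied to $\mathcal{A}$ and $\mathcal{P}_1$ have been carried out (that is, without breakdown), producing tensors $\mathcal{P}_1,\ldots,\mathcal{P}_m\in\mathbb{R}^{J_1\times\cdots\times J_M}$, $\mathcal{Q}_1,\ldots,\mathcal{Q}_m\in\mathbb{R}^{I_1\times\cdots\times I_N}$, $\mathcal{R}_m\in\mathbb{R}^{J_1\times\cdots\times J_M}$ and the upper bidiagonal matrix $B_m\in\mathbb{R}^{m\times m}$. Let $\mathbb{P}_m=[\mathcal{P}_1,\ldots,\mathcal{P}_m]$ and $\mathbb{Q}_m=[\mathcal{Q}_1,\ldots,\mathcal{Q}_m]$. Then $$\mathcal{A}*_M\mathbb{P}_m=\mathbb{Q}_m\times_{N+1}B_m^T,$$ $$\mathcal{A}^T*_N\mathbb{Q}_m=\mathbb{P}_m\times_{M+1}B_m+\mathcal{R}_m\circ e_m,$$ where $\mathcal{A}*_M\mathbb{P}_m=[\mathcal{A}*_M\mathcal{P}_1,\ldots,\mathcal{A}*_M\mathcal{P}_m]$, $\mathcal{A}^T*_N\mathbb{Q}_m=[\mathcal{A}^T*_N\mathcal{Q}_1,\ldots,\mathcal{A}^T*_N\mathcal{Q}_m]$,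 and $e_m$ is the $m$-th canonical basis vector of $\mathbb{R}^m$. Moreover, $\mathcal{P}_1,\ldots,\mathcal{P}_m$ are mutually orthonormal, and $\mathcal{Q}_1,\ldots,\mathcal{Q}_m$ are mutually orthonormal; that is, $\langle\mathcal{P}_i,\mathcal{P}_j\rangle=\delta_{i,j}$ and $\langle\mathcal{Q}_i,\mathcal{Q}_j\rangle=\delta_{i,j}$ for all $1\le i,j\le m$.
   Context: **Tensors.** $\mathbb{R}^{I_1\times\cdots\times I_N}$ is the space of real $N$-th order tensors (arrays) with entries $\mathcal{X}_{i_1\ldots i_N}$. The inner product of two tensors of the same size is the sum of the products of corresponding entries, and $\|\mathcal{X}\|_F=\sqrt{\langle\mathcal{X},\mathcal{X}\rangle}$. Tensors are orthonormal if they are pairwise orthogonal and each has Frobenius norm $1$. **Transpose.** For $\mathcal{A}\in\mathbb{R}^{I_1\times\cdots\times I_N\times J_1\times\cdots\times J_M}$, $\mathcal{A}^T\in\mathbb{R}^{J_1\times\cdots\times J_M\times I_1\times\cdots\times I_N}$ has entries $(\mathcal{A}^T)_{j_1\ldots j_M i_1\ldots i_N}=\mathcal{A}_{i_1\ldots i_N j_1\ldots j_M}$. **Einstein product.** For $\mathcal{X}\in\mathbb{R}^{I_1\times\cdots\times I_L\times K_1\times\cdots\times K_n}$ and $\mathcal{Y}\in\mathbb{R}^{K_1\times\cdots\times K_n\times J_1\times\cdots\times J_p}$ (with $p\ge 0$), $$(\mathcal{X}*_n\mathcal{Y})_{i_1\ldots i_L j_1\ldots j_p}=\sum_{k_1,\ldots,k_n}\mathcal{X}_{i_1\ldots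 i_L k_1\ldots k_n}\mathcal{Y}_{k_1\ldots k_n j_1\ldots j_p}.$$ So for $\mathcal{P}\in\mathbb{R}^{J_1\times\cdots\times J_M}$, $\mathcal{A}*_M\mathcal{P}\in\mathbb{R}^{I_1\times\cdots\times I_N}$, and for $\mathcal{Q}\in\mathbb{R}^{I_1\times\cdots\times I_N}$, $\mathcal{A}^T*_N\mathcal{Q}\in\mathbb{R}^{J_1\times\cdots\times J_M}$. **$n$-mode product.** For $\mathcal{X}\in\mathbb{R}^{I_1\times\cdots\times I_K}$ and a matrix $U\in\mathbb{R}^{J\times I_n}$, $\mathcal{X}\times_n U\in\mathbb{R}^{I_1\times\cdots\times I_{n-1}\times J\times I_{n+1}\times\cdots\times I_K}$ has entries $(\mathcal{X}\times_n U)_{i_1\ldots i_{n-1}\,j\,i_{n+1}\ldots i_K}=\sum_{i_n=1}^{I_n}\mathcal{X}_{i_1\ldots i_K}U_{j i_n}$. **Stacking and outer product.** For tensors $\mathcal{X}_1,\ldots,\mathcal{X}_m$ of the same size $K_1\times\cdots\times K_n$, $[\mathcal{X}_1,\ldots,\mathcal{X}_m]\in\mathbb{R}^{K_1\times\cdots\times K_n\times m}$ is the tensor whose slice with last index $i$ is $\mathcal{X}_i$. For $\mathcal{R}\in\mathbb{R}^{K_1\times\cdots\times K_n}$ and $v\in\mathbb{R}^m$, the outer product $\mathcal{R}\circ v\in\mathbb{R}^{K_1\times\cdots\times K_n\times m}$ has entries $(\mathcal{R}\circ v)_{k_1\ldots k_n i}=\mathcal{R}_{k_1\ldots k_n}v_i$.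 **ELB algorithm.** Input: $\mathcal{A}$, $\mathcal{P}_1$ with $\|\mathcal{P}_1\|_F=1$, and $m$. 1. Set $\mathcal{Q}_1:=\mathcal{A}*_M\mathcal{P}_1$, $\alpha_1:=\|\mathcal{Q}_1\|_F$, then replace $\mathcal{Q}_1$ by $\mathcal{Q}_1/\alpha_1$. 2. For $j=1,\ldots,m$: set $\mathcal{R}_j:=\mathcal{A}^T*_N\mathcal{Q}_j-\alpha_j\mathcal{P}_j$. If $j<m$: set $\beta_j:=\|\mathcal{R}_j\|_F$; if $\beta_j=0$ stop, otherwise set $\mathcal{P}_{j+1}:=\mathcal{R}_j/\beta_j$; set $\mathcal{Q}_{j+1}:=\mathcal{A}*_M\mathcal{P}_{j+1}-\beta_j\mathcal{Q}_j$ and $\alpha_{j+1}:=\|\mathcal{Q}_{j+1}\|_F$; if $\alpha_{j+1}=0$ stop, otherwise replace $\mathcal{Q}_{j+1}$ by $\mathcal{Q}_{j+1}/\alpha_{j+1}$. Carrying out $m$ steps without breakdown means that $\alpha_1,\ldots,\alpha_m$ and $\beta_1,\ldots,\beta_{m-1}$ are all nonzero, so that the tensors $\mathcal{P}_1,\ldots,\mathcal{P}_m$, $\mathcal{Q}_1,\ldots,\mathcal{Q}_m$, $\mathcal{R}_1,\ldots,\mathcal{R}_m$ and the scalars $\alpha_1,\ldots,\alpha_m$, $\beta_1,\ldots,\beta_{m-1}$ are all defined. The matrix $B_m\in\mathbb{R}^{m\times m}$ is the upper bidiagonal matrix with diagonal entries $(B_m)_{j,j}=\alpha_j$ for $1\le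 j\le m$, superdiagonal entries $(B_m)_{j,j+1}=\beta_j$ for $1\le j\le m-1$, and all other entries $0$. *)

(* Defs.v *)
From HB Require Import structures.
From mathcomp Require Import all_boot all_order all_algebra.
From mathcomp Require Import reals.

Set Implicit Arguments.
Unset Strict Implicit.
Unset Printing Implicit Defensive.

Import Order.TTheory GRing.Theory Num.Theory.
Local Open Scope ring_scope.

(* Multi-indices (i_1, ..., i_n) of an array of shape s = [:: I_1; ...; I_n]. *)
Fixpoint multi (s : seq nat) : finType :=
  if s is d :: s' then ('I_d * multi s')%type else unit.

(* The multi-indices of shape s ++ t are the pairs formed of a multi-index of
   shape s and one of shape t; [icat] and [isplit] are the two directions of
   this identification. *)
Fixpoint icat (s t : seq nat) : multi s -> multi t -> multi (s ++ t) :=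
  match s return multi s -> multi t -> multi (s ++ t) with
  | [::] => fun _ v => v
  | d :: s' => fun u v => (u.1, icat u.2 v)
  end.

Fixpoint isplit (s t : seq nat) : multi (s ++ t) -> multi s * multi t :=
  match s return multi (s ++ t) -> multi s * multi t with
  | [::] => fun w => (tt, w)
  | d :: s' => fun w => let uv := isplit w.2 in ((w.1, uv.1), uv.2)
  end.

Lemma icatK (s t : seq nat) (u : multi s) (v : multi t) :
  isplit (icat u v) = (u, v).
Proof.
elim: s u => [|d s IHs] /=; first by case.
by case=> i u /=; rewrite IHs.
Qed.

Lemma isplitK (s t : seq nat) (w : multi (s ++ t)) :
  icat (isplit w).1 (isplit w).2 = w.
Proof. by elim: s w => [|d s IHs] //= [i w] /=; rewrite IHs. Qed.

(* [R^o] rather than [R], so that tensors form a left R-module. *)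
Definition tensor (R : realType) (s : seq nat) := {ffun multi s -> R^o}.

Section Tensors.

Variable R : realType.
Implicit Types s t k : seq nat.

Definition tinner s (X Y : tensor R s) : R := \sum_u X u * Y u.

Definition tnorm s (X : tensor R s) : R := Num.sqrt (tinner X X).

Definition ttr s t (X : tensor R (s ++ t)) : tensor R (t ++ s) :=
  [ffun w => let: (j, i) := isplit w in X (icat i j)].

(* X *_n Y, where n = size k is the number of contracted modes. *)
Definition einstein s k t (X : tensor R (s ++ k)) (Y : tensor R (k ++ t)) :
    tensor R (s ++ t) :=
  [ffun w => let: (i, j) := isplit w in
             \sum_(c : multi k) X (icat i c) * Y (icat c j)].

(* The case p = 0 of the Einstein product, separate from [einstein] because
   k ++ [::] is not convertible to k. *)
Definition einstein0 s k (X : tensor R (s ++ k)) (Y : tensor R k) :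
    tensor R s :=
  [ffun i => \sum_(c : multi k) X (icat i c) * Y c].

(* X x_n U, where n = size s + 1 is the position of the mode of dimension d. *)
Definition mode_prod s d t e (X : tensor R (s ++ d :: t)) (U : 'M[R]_(e, d)) :
    tensor R (s ++ e :: t) :=
  [ffun w => let: (a, (j, b)) := @isplit s (e :: t) w in
             \sum_(i < d) X (@icat s (d :: t) a (i, b)) * U j i].

Definition stack s m (X : 'I_m -> tensor R s) : tensor R (s ++ [:: m]) :=
  [ffun w => let: (u, (i, _)) := @isplit s [:: m] w in X i u].

Definition touter s m (X : tensor R s) (v : 'cV[R]_m) :
    tensor R (s ++ [:: m]) :=
  [ffun w => let: (u, (i, _)) := @isplit s [:: m] w in
             X u * v i 0].

(* The k-th canonical basis vector of R^m, with 1 <= k <= m. *)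
Definition basis_vec m (k : nat) : 'cV[R]_m := \col_(i < m) (i.+1 == k)%:R.

Section ELB.

Variables (I J : seq nat) (A : tensor R (I ++ J)) (P1 : tensor R J).

Record elb_state := ElbState
  { elbP_ : tensor R J; elbQ_ : tensor R I; elb_alpha_ : R }.

(* From a direction P and the unnormalized Q, set alpha := ||Q||_F and replace
   Q by Q / alpha. *)
Definition elb_normalize (P : tensor R J) (Q : tensor R I) : elb_state :=
  let alpha := tnorm Q in ElbState P (alpha^-1 *: Q) alpha.

Definition elb_residual (S : elb_state) : tensor R J :=
  einstein0 (ttr A) (elbQ_ S) - elb_alpha_ S *: elbP_ S.

(* Indices start at 0: [elb j] holds P_{j+1}, Q_{j+1} and alpha_{j+1}.
   Inversion is total (0^-1 = 0), so the iteration continues with meaningless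
   values where the algorithm would stop; only values satisfying
   [elb_no_breakdown] below are those of the algorithm. *)
Fixpoint elb (j : nat) : elb_state :=
  if j is j'.+1 then
    let S := elb j' in
    let res := elb_residual S in
    let beta := tnorm res in
    let P := beta^-1 *: res in
    elb_normalize P (einstein0 A P - beta *: elbQ_ S)
  else elb_normalize P1 (einstein0 A P1).

Definition elbP (j : nat) : tensor R J := elbP_ (elb j).
Definition elbQ (j : nat) : tensor R I := elbQ_ (elb j).
Definition elb_alpha (j : nat) : R := elb_alpha_ (elb j).
Definition elbR (j : nat) : tensor R J := elb_residual (elb j).
Definition elb_beta (j : nat) : R := tnorm (elbR j).

Definition elb_no_breakdown (m : nat) : Prop :=
  (forall j, (j < m)%N -> elb_alpha j <> 0) /\
  (forall j, (j.+1 < m)%N -> elb_beta j <> 0).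

Definition elbB (m : nat) : 'M[R]_m :=
  \matrix_(i < m, j < m)
    if i == j then elb_alpha i
    else if i.+1 == j then elb_beta i else 0.

End ELB.

End Tensors.

(* Main.v *)
(* Both identities restate the two recurrences of the algorithm slice by slice
   and do not need orthogonality. Orthonormality is proved by a simultaneous
   induction on P and Q: since A and A^T are adjoint, <R_k, P_i> equals
   <Q_k, A P_i> - alpha_k delta_{k,i}, where A P_i is a combination of Q_i and
   Q_{i-1} only, and <A P_{k+1} - beta_k Q_k, Q_i> equals
   <P_{k+1}, A^T Q_i> - beta_k delta_{k,i}, where A^T Q_i is a combination of
   P_i and P_{i+1} only. *)

Require Import Defs.
From HB Require Import structures.
From mathcomp Require Import all_boot all_order all_algebra.
From mathcomp Require Import reals.

Set Implicit Arguments.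
Unset Strict Implicit.
Unset Printing Implicit Defensive.

Import Order.TTheory GRing.Theory Num.Theory.
Local Open Scope ring_scope.

Section TensorLemmas.

Variable R : realType.
Implicit Types s t : seq nat.

Lemma tinnerC s (X Y : tensor R s) : tinner X Y = tinner Y X.
Proof. by apply: eq_bigr => u _; rewrite mulrC. Qed.

Lemma tinnerDl s (X Y Z : tensor R s) :
  tinner (X + Y) Z = tinner X Z + tinner Y Z.
Proof.
by rewrite /tinner -big_split; apply: eq_bigr => u _; rewrite ffunE mulrDl.
Qed.

Lemma tinnerZl s (a : R) (X Z : tensor R s) :
  tinner (a *: X) Z = a * tinner X Z.
Proof.
by rewrite /tinner mulr_sumr; apply: eq_bigr => u _; rewrite ffunE mulrA.
Qed.

Lemma tinnerDr s (X Y Z : tensor R s) :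
  tinner Z (X + Y) = tinner Z X + tinner Z Y.
Proof. by rewrite tinnerC tinnerDl !(tinnerC Z). Qed.

Lemma tinnerZr s (a : R) (X Z : tensor R s) :
  tinner Z (a *: X) = a * tinner Z X.
Proof. by rewrite tinnerC tinnerZl (tinnerC Z). Qed.

Lemma tinnerBl s (X Y Z : tensor R s) :
  tinner (X - Y) Z = tinner X Z - tinner Y Z.
Proof. by rewrite -scaleN1r tinnerDl tinnerZl mulN1r. Qed.

Lemma sqr_tnorm s (X : tensor R s) : tnorm X ^+ 2 = tinner X X.
Proof. by rewrite sqr_sqrtr // sumr_ge0 // => u _; rewrite -expr2 sqr_ge0. Qed.

Lemma tinner_normalized s (X : tensor R s) :
  tnorm X != 0 -> tinner ((tnorm X)^-1 *: X) ((tnorm X)^-1 *: X) = 1.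
Proof.
by move=> X0; rewrite tinnerZl tinnerZr -sqr_tnorm expr2 mulKf // mulVf.
Qed.

(** Adjointness of [A] and its transpose: both sides are one double sum over multi-indices, taken in
    the two orders. *)
Lemma tinner_ttr s t (A : tensor R (s ++ t)) (X : tensor R t) (Y : tensor R s) :
  tinner (einstein0 (ttr A) Y) X = tinner Y (einstein0 A X).
Proof.
rewrite /tinner.
under eq_bigr => v _ do rewrite ffunE mulr_suml.
under [RHS]eq_bigr => u _ do rewrite ffunE mulr_sumr.
rewrite exchange_big; apply: eq_bigr => u _; apply: eq_bigr => v _.
by rewrite ffunE icatK mulrCA mulrA.
Qed.

Lemma eq_stack s m (X Y : 'I_m -> tensor R s) : X =1 Y -> stack X = stack Y.
Proof.
move=> eXY; apply/ffunP => w; rewrite !ffunE; case: isplit => u [i b].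
by rewrite eXY.
Qed.

Lemma stackD s m (X Y : 'I_m -> tensor R s) :
  stack (fun i => X i + Y i) = stack X + stack Y.
Proof.
by apply/ffunP => w; rewrite !ffunE; case: isplit => u [i b]; rewrite ffunE.
Qed.

(** With the two lemmas below, this turns every term of the two identities into a stack, so that
    only slices remain to be compared. *)
Lemma einstein_stack s t m (A : tensor R (s ++ t)) (X : 'I_m -> tensor R t) :
  einstein A (stack X) = stack (fun i => einstein0 A (X i)).
Proof.
apply/ffunP => w; rewrite !ffunE; case: isplit => u [i b].
by rewrite ffunE; apply: eq_bigr => c _; rewrite ffunE icatK.
Qed.

Lemma mode_prod_stack s d e (X : 'I_d -> tensor R s) (U : 'M[R]_(e, d)) :
  mode_prod (stack X) U = stack (fun j => \sum_i U j i *: X i).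
Proof.
apply/ffunP => w; rewrite !ffunE; case: isplit => u [j b].
rewrite sum_ffunE; apply: eq_bigr => i _.
by rewrite !ffunE icatK mulrC.
Qed.

Lemma touter_stack s m (X : tensor R s) (v : 'cV[R]_m) :
  touter X v = stack (fun i => v i 0 *: X).
Proof.
apply/ffunP => w; rewrite !ffunE; case: isplit => u [i b].
by rewrite ffunE mulrC.
Qed.

End TensorLemmas.

Section ELBLemmas.

Variables (R : realType) (I J : seq nat) (A : tensor R (I ++ J)).
Variable P1 : tensor R J.

Local Notation P := (elbP A P1).
Local Notation Q := (elbQ A P1).
Local Notation Res := (elbR A P1).
Local Notation alpha := (elb_alpha A P1).
Local Notation beta := (elb_beta A P1).

(** The two conditions exclude each other, so an entry splits as a sum over the two bands and each
    band can be summed separately. *)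
Lemma elbB_E m (i j : 'I_m) :
  elbB A P1 m i j = alpha i *+ (i == j) + beta i *+ (i.+1 == j).
Proof.
rewrite mxE; case: eqVneq => [->|_]; last by rewrite add0r; case: eqP.
by rewrite (gtn_eqF (ltnSn _)) addr0.
Qed.

(** The superdiagonal entry is absent exactly in the last row; there the residual term of the second
    identity takes its place. *)
Lemma sum_elbB_row (V : lmodType R) m (F : nat -> V) (j : 'I_m) :
  \sum_(i < m) elbB A P1 m j i *: F i
  = alpha j *: F j + (if (j.+1 < m)%N then beta j *: F j.+1 else 0).
Proof.
under eq_bigr => i _ do rewrite elbB_E scalerDl.
rewrite big_split /=; congr (_ + _).
  rewrite (bigD1 j) //= eqxx big1 ?addr0 // => i /negPf ij.
  by rewrite eq_sym ij scale0r.
rewrite -(big_ord1_eq +%R (fun i => beta j *: F i)) [RHS]big_mkcond.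
by apply: eq_bigr => i _; rewrite eq_sym; case: eqP; rewrite ?scale0r.
Qed.

(** Columns occur because the first identity uses the transpose of [elbB]; column 0 carries no
    superdiagonal entry. *)
Lemma sum_elbB_col (V : lmodType R) m (F : nat -> V) (j : 'I_m) :
  \sum_(i < m) elbB A P1 m i j *: F i
  = alpha j *: F j + (if val j is k.+1 then beta k *: F k else 0).
Proof.
under eq_bigr => i _ do rewrite elbB_E scalerDl.
rewrite big_split /=; congr (_ + _).
  rewrite (bigD1 j) //= eqxx big1 ?addr0 // => i /negPf ij.
  by rewrite ij scale0r.
case: j => [[|k] lt_km] /=; first by rewrite big1 // => i _; rewrite scale0r.
have := big_ord1_eq +%R (fun i => beta i *: F i) k m.
rewrite (ltnW lt_km) => <-; rewrite [RHS]big_mkcond.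
by apply: eq_bigr => i _; rewrite eqSS; case: eqP; rewrite ?scale0r.
Qed.

Lemma elbP_S j : P j.+1 = (beta j)^-1 *: Res j.
Proof. by []. Qed.

Lemma elbQ_S j :
  Q j.+1 = (alpha j.+1)^-1 *: (einstein0 A (P j.+1) - beta j *: Q j).
Proof. by []. Qed.

Lemma elb_ttrA_Q j : einstein0 (ttr A) (Q j) = alpha j *: P j + Res j.
Proof. by rewrite addrC subrK. Qed.

Lemma elbR_E j : beta j != 0 -> Res j = beta j *: P j.+1.
Proof. by move=> b0; rewrite scalerA mulfV ?scale1r. Qed.

(** Multiplying by [alpha j] undoes the normalization of [Q j]; at index 0 nothing was subtracted,
    hence the zero term. *)
Lemma elb_A_P j : alpha j != 0 ->
  einstein0 A (P j) = alpha j *: Q j + (if j is k.+1 then beta k *: Q k else 0).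
Proof.
case: j => [|k] a0; rewrite scalerA mulfV // scale1r ?addr0 //.
by rewrite subrK.
Qed.

Lemma tinner_elbQ_unit j : alpha j != 0 -> tinner (Q j) (Q j) = 1.
(* Splitting on [j] lets [elb] reduce; then [alpha j] is the norm of the tensor that [Q j]
   rescales. *)
Proof. by case: j => [|j]; apply: tinner_normalized. Qed.

Lemma tinner_elbP_unit j : beta j != 0 -> tinner (P j.+1) (P j.+1) = 1.
Proof. exact: tinner_normalized. Qed.

(** The bound [k] on both indices puts all orthonormality so far into the induction hypothesis;
    [P k.+1] comes first because [Q k.+1] relies on it. *)
Lemma elb_orthonormal m : tnorm P1 = 1 -> elb_no_breakdown A P1 m ->
  forall k, (k < m)%N -> forall i j, (i <= k)%N -> (j <= k)%N ->
  tinner (P i) (P j) = (i == j)%:R /\ tinner (Q i) (Q j) = (i == j)%:R.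
Proof.
move=> P1_unit [a0 b0]; elim=> [|k IHk] lt_km.
  move=> [|//] [|//] _ _; split; last by apply/tinner_elbQ_unit/eqP/a0.
  by rewrite -sqr_tnorm P1_unit expr1n.
have {}IHk := IHk (ltnW lt_km).
have a0' j : (j <= k.+1)%N -> alpha j != 0.
  by move=> le_jk; apply/eqP/a0/(leq_ltn_trans le_jk).
have b0' j : (j <= k)%N -> beta j != 0.
  by move=> le_jk; apply/eqP/b0/(leq_ltn_trans _ lt_km).
have orthP i : (i <= k)%N -> tinner (P k.+1) (P i) = 0.
  move=> le_ik; rewrite elbP_S tinnerZl tinnerBl tinner_ttr tinnerZl.
  have -> : tinner (Q k) (einstein0 A (P i)) = alpha i * (k == i)%:R.
    rewrite elb_A_P ?a0' ?leqW // tinnerDr tinnerZr.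
    have [_ ->] := IHk k i (leqnn k) le_ik.
    case: i le_ik => [|i] lt_ik.
      (* At i = 0 the missing term is the zero tensor, written as a multiple by 0 so that linearity
         evaluates it. *)
      by rewrite -(scale0r 0) tinnerZr mul0r addr0.
    rewrite tinnerZr; have [_ ->] := IHk k i (leqnn k) (ltnW lt_ik).
    by rewrite (gtn_eqF lt_ik) mulr0 addr0.
  have [-> _] := IHk k i (leqnn k) le_ik.
  (* For i = k the two terms cancel; otherwise both vanish. *)
  by case: eqVneq => [->|_]; rewrite ?subrr ?mulr0 // subrr mulr0.
have orthQ i : (i <= k)%N -> tinner (Q k.+1) (Q i) = 0.
  move=> le_ik; rewrite elbQ_S tinnerZl tinnerBl tinnerZl.
  rewrite [tinner (einstein0 _ _) _]tinnerC -tinner_ttr elb_ttrA_Q.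
  rewrite elbR_E ?b0' // tinnerDl tinnerZl [tinner (beta i *: _) _]tinnerZl.
  rewrite [tinner (P i) _]tinnerC orthP // mulr0 add0r.
  have [_ ->] := IHk k i (leqnn k) le_ik.
  (* Up to a factor, beta_i <P_{i+1}, P_{k+1}> - beta_k delta_{k,i} remains: unit norm settles i =
     k, and for i < k [orthP] applies at i+1. *)
  move: le_ik; rewrite leq_eqVlt => /predU1P[->|lt_ik].
    by rewrite tinner_elbP_unit ?b0' // eqxx subrr mulr0.
  by rewrite tinnerC orthP // (gtn_eqF lt_ik) !mulr0 subrr mulr0.
move=> i j; rewrite (leq_eqVlt i) (leq_eqVlt j) !ltnS.
move=> /predU1P[->|le_ik] /predU1P[->|le_jk]; last exact: IHk.
- by rewrite eqxx tinner_elbP_unit ?tinner_elbQ_unit ?a0' ?b0'.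
- by rewrite orthP ?orthQ // gtn_eqF.
- by rewrite tinnerC orthP // tinnerC orthQ // ltn_eqF.
Qed.

End ELBLemmas.

Theorem theorem3p1 (R : realType) (M N : nat) (M_gt0 : (0 < M)%N)
    (le_MN : (M <= N)%N) (I : N.-tuple nat) (J : M.-tuple nat)
    (A : tensor R (I ++ J)) (P1 : tensor R J) (P1_unit : tnorm P1 = 1)
    (m : nat) (m_gt0 : (0 < m)%N)
    (le_m : (m <= minn (\prod_(d <- I) d) (\prod_(d <- J) d))%N)
    (no_breakdown : elb_no_breakdown A P1 m) :
  let P := fun i : 'I_m => elbP A P1 i in
  let Q := fun i : 'I_m => elbQ A P1 i in
  let Rm := elbR A P1 m.-1 in
  let B := elbB A P1 m in
  [/\ einstein A (stack P) = stack (fun i => einstein0 A (P i))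
        /\ einstein A (stack P) = mode_prod (stack Q) B^T,
      einstein (ttr A) (stack Q) = stack (fun i => einstein0 (ttr A) (Q i))
        /\ einstein (ttr A) (stack Q)
           = mode_prod (stack P) B + touter Rm (basis_vec R m m),
      forall i j : 'I_m, tinner (P i) (P j) = (i == j)%:R
    & forall i j : 'I_m, tinner (Q i) (Q j) = (i == j)%:R].
Proof.
move=> P Q Rm B; have [a0 b0] := no_breakdown.
have orthonormal (i j : 'I_m) :
    tinner (P i) (P j) = (i == j)%:R /\ tinner (Q i) (Q j) = (i == j)%:R.
  apply: (elb_orthonormal P1_unit no_breakdown (k := maxn i j)).
  - by rewrite gtn_max !ltn_ord.
  - exact: leq_maxl.
  - exact: leq_maxr.
split.
- rewrite mode_prod_stack einstein_stack; split=> //; apply: eq_stack => j.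
  under eq_bigr => i _ do rewrite mxE.
  by rewrite sum_elbB_col elb_A_P //; apply/eqP/a0.
- rewrite mode_prod_stack touter_stack -stackD einstein_stack; split=> //.
  apply: eq_stack => j; rewrite sum_elbB_row elb_ttrA_Q -addrA mxE.
  (* [basis_vec] counts from 1, so its entry at [j] is 1 only when j+1 = m: there [Rm] is the whole
     remainder, and elsewhere the residual is beta_j P_{j+1}. *)
  congr (_ + _); have := ltn_ord j; rewrite leq_eqVlt => /predU1P[jm|lt_jm].
    by rewrite jm ltnn eqxx scale1r add0r /Rm -[X in X.-1]jm.
  by rewrite lt_jm (ltn_eqF lt_jm) scale0r addr0 elbR_E //; apply/eqP/b0.
- by move=> i j; have [] := orthonormal i j.
- by move=> i j; have [] := orthonormal i j.
Qed.
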